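(* Let $X$ be a real vector space and let $C\subseteq X$ be a convex set. For any $x\in C$ there is a unique face $F$ of $C$ such that $x\in\operatorname{icr} F$. Consequently, $C$ is the disjoint union of the intrinsic cores of its faces: $C=\bigcup_{F} \operatorname{icr} F$, where $F$ ranges over all faces of $C$, and $\operatorname{icr} E\cap\operatorname{icr} F=\emptyset$ for any two distinct faces $E,F$ of $C$.
   Context: For $y,z\in X$, the open segment is $(y,z)=\{ty+(1-t)z \mid t\in(0,1)\}$; the degenerate case $(y,y)=\{y\}$ is allowed. A face of a convex set $C$ is a convex subset $F\subseteq C$ (possibly empty or equal to $C$) such that for every $x\in F$ and all $y,z\in C$ with $x\in(y,z)$ we have $y,z\in F$. The intrinsic core of a convex set $D$ is $\operatorname{icr} D=\{x\in D \mid \forall y\in D\ \exists z\in D \text{ such that } x\in(y,z)\}$; in particular $\operatorname{icr}\{x\}=\{x\}$ and $\operatorname{icr}\emptyset=\emptyset$. *)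

(* Defs.v *)
From mathcomp Require Import all_boot all_order all_algebra.
From mathcomp Require Import all_classical all_reals.
From mathcomp Require Import convex.

Set Implicit Arguments.
Unset Strict Implicit.
Unset Printing Implicit Defensive.

Import Order.TTheory GRing.Theory Num.Theory.
Local Open Scope classical_set_scope.
Local Open Scope ring_scope.

(* This is [set y] when y = z. *)
Definition open_segment (R : realType) (X : lmodType R) (y z : X) : set X :=
  [set t *: y + (1 - t) *: z | t in [set t : R | 0 < t < 1]].

(* Neither nonempty nor proper: set0 and C itself are allowed. *)
Definition is_face (R : realType) (X : lmodType R) (C F : set X) : Prop :=
  [/\ convex_set F, F `<=` C &
      forall x y z, F x -> C y -> C z -> open_segment y z x -> F y /\ F z].

Definition icr (R : realType) (X : lmodType R) (D : set X) : set X :=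
  [set x | D x /\ forall y, D y -> exists2 z, D z & open_segment y z x].

(* Main.v *)
(* The face of C whose intrinsic core contains x is the set of the endpoints y
   of the open segments (y, z) in C through x: any face containing x contains
   this set, and a face with x in its intrinsic core is contained in it. *)
Require Import Defs.
From mathcomp Require Import all_boot all_order all_algebra.
From mathcomp Require Import all_classical all_reals.
From mathcomp Require Import convex.
From mathcomp Require Import interval_inference.
From mathcomp Require Import ring lra.

Local Open Scope classical_set_scope.
Local Open Scope ring_scope.

Import Order.TTheory GRing.Theory Num.Theory.

Section MinimalFace.
Context {R : realType} {X : lmodType R}.
Implicit Types (C F : set X) (x y z : X) (a b t : R).

Definition minimal_face C x : set X :=
  [set y | C y /\ exists2 z, C z & open_segment y z x].

Lemma convex_set_comb C y z t : convex_set C -> C y -> C z -> 0 <= t <= 1 ->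
  C (t *: y + (1 - t) *: z).
Proof.
move=> hC Cy Cz /andP[t0 t1].
by have := hC y z (Itv01 t0 t1) (mem_set Cy) (mem_set Cz) => /set_mem.
Qed.

(** Weights need not sum to 1 here: the only division is by [a + b], done once in this proof, so
    that later identities between coefficients are polynomial. *)
Lemma convex_set_weighted C y z a b : convex_set C -> C y -> C z ->
  0 <= a -> 0 <= b -> 0 < a + b ->
  exists2 w, C w & (a + b) *: w = a *: y + b *: z.
Proof.
move=> hC Cy Cz a0 b0 ab0; have abN0 : a + b != 0 by rewrite gt_eqF.
exists ((a / (a + b)) *: y + (1 - a / (a + b)) *: z).
  apply: convex_set_comb => //.
  by rewrite divr_ge0 ?(ltW ab0)// ler_pdivrMr// mul1r lerDl.
by rewrite scalerDr !scalerA; congr (_ *: _ + _ *: _); field.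
Qed.

(** Normalising the weights gives the parameter [a / (a + b)], strictly between 0 and 1 because both
    weights are positive. *)
Lemma open_segment_weighted x y z a b : 0 < a -> 0 < b ->
  (a + b) *: x = a *: y + b *: z -> open_segment y z x.
Proof.
move=> a0 b0 xE; have ab0 : 0 < a + b by rewrite addr_gt0.
have abN0 : a + b != 0 by rewrite gt_eqF.
exists (a / (a + b)).
  by rewrite /= divr_gt0//= ltr_pdivrMr// mul1r ltrDl.
apply: (scalerI abN0); rewrite xE scalerDr !scalerA.
by congr (_ *: _ + _ *: _); field.
Qed.

Lemma open_segment_sym x y z : open_segment y z x -> open_segment z y x.
Proof.
case=> t /= /andP[t0 t1] <-; apply: (@open_segment_weighted _ _ _ (1 - t) t).
- by rewrite subr_gt0.
- by [].
- by rewrite subrK scale1r addrC.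
Qed.

Lemma open_segment_refl x : open_segment x x x.
Proof.
by apply: (@open_segment_weighted _ _ _ 1 1); rewrite ?ltr01// scalerDl.
Qed.

(** Write x = a y1 + (1 - a) z1 = b y2 + (1 - b) z2. Adding p b times the first equation to (1 - p)
    a times the second gives y1 and y2 the weights a b p and a b (1 - p), that is, a b times the
    point p y1 + (1 - p) y2. *)
Lemma convex_minimal_face C x : convex_set C -> convex_set (minimal_face C x).
Proof.
move=> hC; apply/convex_setW => y1 y2 /set_mem[Cy1 [z1 Cz1 [a /= a01 x1]]].
move=> /set_mem[Cy2 [z2 Cz2 [b /= b01 x2]]] k k0 k1; apply/mem_set.
have {a01}[a0 a1] : 0 < a /\ 0 < 1 - a by move: a01; lra.
have {b01}[b0 b1] : 0 < b /\ 0 < 1 - b by move: b01; lra.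
set p := k%:num in k0 k1 *.
split; first by apply: convex_set_comb => //; rewrite !ltW.
have p1 : 0 < 1 - p by rewrite subr_gt0.
(* These are the weights left on [z1] and [z2]; the far endpoint [w] is their weighted mean. *)
have u0 : 0 < p * b * (1 - a) by rewrite !mulr_gt0.
have v0 : 0 < (1 - p) * a * (1 - b) by rewrite !mulr_gt0.
have [w Cw wE] := convex_set_weighted _ _ _ _ _ hC Cz1 Cz2
  (ltW u0) (ltW v0) (addr_gt0 u0 v0).
exists w => //; change (open_segment (p *: y1 + (1 - p) *: y2) w x).
apply: (open_segment_weighted _ _ _ _ _ (mulr_gt0 a0 b0) (addr_gt0 u0 v0)).
have -> : a * b + (p * b * (1 - a) + (1 - p) * a * (1 - b)) =
  p * b + (1 - p) * a by ring.
(* The copy of [x] with weight p b is expanded along (y1, z1), the other along (y2, z2). *)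
rewrite wE scalerDl -[in X in X + _ = _]x1 -x2 !scalerDr !scalerA addrACA.
by congr (_ *: _ + _ *: _ + _); ring.
Qed.

(* If w is in (y, z) and x is in (w, u), then x is in (y, v) for some v in the
   segment [z, u]. *)
Lemma is_face_minimal_face C x : convex_set C -> is_face C (minimal_face C x).
Proof.
move=> hC; have endpoint w y z : minimal_face C x w -> C y -> C z ->
    open_segment y z w -> minimal_face C x y.
  move=> [Cw [u Cu [s /= s01 xE]]] Cy Cz [t /= t01 wE]; split => //.
  have {s01}[s0 s1] : 0 < s /\ 0 < 1 - s by move: s01; lra.
  have {t01}[t0 t1] : 0 < t /\ 0 < 1 - t by move: t01; lra.
  (* Substituting [w] gives x = s t y + s (1 - t) z + (1 - s) u; the last two terms merge into a
     multiple of [v]. *)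
  have st1 := mulr_gt0 s0 t1.
  have [v Cv vE] := convex_set_weighted _ _ _ _ _ hC Cz Cu
    (ltW st1) (ltW s1) (addr_gt0 st1 s1).
  exists v => //.
  apply: (open_segment_weighted _ _ _ _ _ (mulr_gt0 s0 t0) (addr_gt0 st1 s1)).
  have -> : s * t + (s * (1 - t) + (1 - s)) = 1 by ring.
  by rewrite vE scale1r -xE -wE scalerDr !scalerA addrA.
split; [exact: convex_minimal_face | by move=> y [] |].
move=> w y z xw Cy Cz yzw; split; first exact: endpoint xw Cy Cz yzw.
exact: endpoint xw Cz Cy (open_segment_sym _ _ _ yzw).
Qed.

(** The two endpoints of a segment through [x] play symmetric roles, so the far endpoint [z] lies in
    the minimal face too; [x] itself does by the degenerate segment (x, x). *)
Lemma icr_minimal_face C x : C x -> icr (minimal_face C x) x.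
Proof.
move=> Cx; split.
  by split=> //; exists x => //; exact: open_segment_refl.
move=> y [Cy [z Cz yzx]]; exists z => //.
by split=> //; exists y => //; exact: open_segment_sym.
Qed.

Lemma face_icr_unique C F x : is_face C F -> icr F x -> F = minimal_face C x.
Proof.
move=> [_ FC Fface] [Fx xF]; apply/seteqP; split=> y.
  move=> Fy; split; first exact: FC.
  by have [z Fz yzx] := xF y Fy; exists z => //; exact: FC.
by move=> [Cy [z Cz yzx]]; have [] := Fface x y z Fx Cy Cz yzx.
Qed.

End MinimalFace.

Theorem theorem3p15 (R : realType) (X : lmodType R) (C : set X)
  (hC : convex_set C) :
  [/\ forall x, C x -> exists! F : set X, is_face C F /\ icr F x,
      C = \bigcup_(F in [set F | is_face C F]) icr F &
      forall E F : set X, is_face C E -> is_face C F -> E <> F ->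
        icr E `&` icr F = set0].
Proof.
split.
- move=> x Cx; exists (minimal_face C x); split.
    by split; [exact: is_face_minimal_face | exact: icr_minimal_face].
  by move=> F [CF Fx]; rewrite (face_icr_unique _ _ _ CF Fx).
- apply/seteqP; split=> [x Cx | x [F [_ FC _] [Fx _]]]; last exact: FC.
  exists (minimal_face C x); first exact: is_face_minimal_face.
  exact: icr_minimal_face.
(* A common point [x] forces both faces to equal [minimal_face C x]. *)
- move=> E F CE CF neqEF; rewrite -subset0 => x [Ex Fx]; apply: neqEF.
  by rewrite (face_icr_unique _ _ _ CE Ex) (face_icr_unique _ _ _ CF Fx).
Qed.
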